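(* Let $\pi$ be an irreducible polynomial in $\mathbf F_r[T]$ of degree $d$, let $\mathcal O=\mathbf F_\pi[[\pi]]$ be the completion of $\mathbf F_r[T]$ at $\pi$, and let $K$ be its fraction field. The hyperdifferential functions $\mathcal D_{j,T}$ on $\mathbf F_r[T]$, extended by continuity to $\mathcal O$, form an orthonormal basis of the space of continuous $\mathbf F_\pi$-linear functions from $\mathcal O$ to $K$. Moreover, the extension of the sequence $\{\mathcal D_{j,T}\}_{j\ge0}$ by $r^d$-digit expansions is an orthonormal basis of $C(\mathcal O,K)$.
   Context: $\mathbf F_\pi=\mathbf F_r[T]/(\pi)$ is the residue field, a field of size $r^d$, which is identified with the unique coefficient field of $\mathcal O$ (so $\mathcal O\cong\mathbf F_\pi[[\pi]]$). $\mathcal D_{j,T}$ is the $\mathbf F_r$-linear map on $\mathbf F_r[T]$ with $\mathcal D_{j,T}(T^m)=\binom{m}{j}T^{m-j}$; it is $\pi$-adically continuous and extends by continuity to $\mathcal O$. $C(\mathcal O,K)$ is the $K$-Banach space of continuous functions $\mathcal O\to K$ with the sup-norm, and the continuous $\mathbf F_\pi$-linear maps form a closed subspace. An orthonormal basis of a $K$-Banach space $E$ is a sequence $\{f_n\}$ such that every $x\in E$ is $x=\sum c_nf_n$ with $c_n\in K$, $c_n\to0$, $\|x\|=\max|c_n|$. Extension by $Q$-digits ($Q=r^d$) of a sequence $(e_j)$: for $i=c_0+c_1Q+\dots+c_{n-1}Q^{n-1}$ with $0\le c_j\le Q-1$, the function $e_0^{c_0}\cdots e_{n-1}^{c_{n-1}}$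 (pointwise product, $e_j^0=1$). *)

(* Defs.v *)
From HB Require Import structures.
From mathcomp Require Import all_boot all_order all_algebra all_field.
From mathcomp Require Import boolp classical_sets.
Set Implicit Arguments. Unset Strict Implicit. Unset Printing Implicit Defensive.
Import GRing.Theory.
Local Open Scope ring_scope.

(* Concrete model of O = completion of F[T] at pi, as the inverse limit of
   F[T]/(pi^n): an element of O is a sequence x of polynomials with
   x n reduced mod pi^n and x n.+1 = x n mod pi^n.
   An element of K = Frac O is represented by a pair (k, y) standing for
   y / pi^k (a non-canonical representation; all predicates below are
   invariant under change of representative). *)
Section PiAdic.
Variables (F : finFieldType) (pi : {poly F}).

Definition Oseq := nat -> {poly F}.
Definition Kt := (nat * Oseq)%type.
Definition Ofun := Oseq -> Kt.

Definition Oelt (x : Oseq) : Prop :=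
  (forall n, x n %% pi ^+ n = x n) /\ (forall n, x n.+1 %% pi ^+ n = x n).

Definition Oadd (x y : Oseq) : Oseq := fun n => (x n + y n) %% pi ^+ n.
Definition Omul (x y : Oseq) : Oseq := fun n => (x n * y n) %% pi ^+ n.
Definition Oopp (x : Oseq) : Oseq := fun n => (- x n) %% pi ^+ n.
Definition Osub (x y : Oseq) : Oseq := Oadd x (Oopp y).
Definition Oof (p : {poly F}) : Oseq := fun n => p %% pi ^+ n.
Fixpoint Opow (x : Oseq) (m : nat) : Oseq :=
  match m with 0 => Oof 1 | m'.+1 => Omul (Opow x m') x end.
Definition Ovge (x : Oseq) (N : nat) : Prop := x N = 0.

Definition Kelt (a : Kt) : Prop := Oelt a.2.
Definition Kzero : Kt := (0%N, Oof 0).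
Definition Kone : Kt := (0%N, Oof 1).
Definition Kadd (a b : Kt) : Kt :=
  ((a.1 + b.1)%N, Oadd (Omul (Oof (pi ^+ b.1)) a.2) (Omul (Oof (pi ^+ a.1)) b.2)).
Definition Kmul (a b : Kt) : Kt := ((a.1 + b.1)%N, Omul a.2 b.2).
Definition Kopp (a : Kt) : Kt := (a.1, Oopp a.2).
Definition Ksub (a b : Kt) : Kt := Kadd a (Kopp b).
Definition KofO (x : Oseq) : Kt := (0%N, x).
Fixpoint Kpow (a : Kt) (m : nat) : Kt :=
  match m with 0 => Kone | m'.+1 => Kmul (Kpow a m') a end.
Fixpoint Ksum (m : nat) (h : nat -> Kt) : Kt :=
  match m with 0 => Kzero | m'.+1 => Kadd (Ksum m' h) (h m') end.
Fixpoint Kprod (m : nat) (h : nat -> Kt) : Kt :=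
  match m with 0 => Kone | m'.+1 => Kmul (Kprod m' h) (h m') end.

(* valuation of a = y/pi^k is >= M  (i.e. |a| <= |pi|^M) *)
Definition Kvge (a : Kt) (M : int) : Prop :=
  forall n : nat, (n%:Z <= M + (a.1)%:Z)%R -> a.2 n = 0.
Definition Keq (a b : Kt) : Prop := forall M : int, Kvge (Ksub a b) M.

(* Q = r^d = #|F_pi| *)
Definition Qpi : nat := (#|F| ^ (size pi).-1)%N.

(* The coefficient field F_pi inside O: the roots of X^Q - X in O. *)
Definition coefF (c : Oseq) : Prop := Oelt c /\ Opow c Qpi = c.

Definition KfunO (f : Ofun) : Prop := forall x, Oelt x -> Kelt (f x).

Definition Kcont (f : Ofun) : Prop :=
  forall x, Oelt x -> forall M : int, exists N : nat,
    forall y, Oelt y -> Ovge (Osub x y) N -> Kvge (Ksub (f x) (f y)) M.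

Definition FpiLinear (f : Ofun) : Prop :=
  (forall x y, Oelt x -> Oelt y -> Keq (f (Oadd x y)) (Kadd (f x) (f y))) /\
  (forall c x, coefF c -> Oelt x -> Keq (f (Omul c x)) (Kmul (KofO c) (f x))).

Definition COK (f : Ofun) : Prop := KfunO f /\ Kcont f.
Definition CLinOK (f : Ofun) : Prop := COK f /\ FpiLinear f.

(* orthonormal basis of the subspace E (sup norm, values discrete) *)
Definition ONB (E : Ofun -> Prop) (g : nat -> Ofun) : Prop :=
  (forall n, E (g n)) /\
  forall f, E f -> exists c : nat -> Kt,
    (forall n, Kelt (c n)) /\
    (forall M : int, exists N, forall n, (N <= n)%N -> Kvge (c n) M) /\
    (forall M : int, exists N, forall m, (N <= m)%N -> forall t, Oelt t ->
        Kvge (Ksub (f t) (Ksum m (fun n => Kmul (c n) (g n t)))) M) /\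
    (* ||f|| = max |c_n| *)
    (forall M : int, (forall t, Oelt t -> Kvge (f t) M) <-> (forall n, Kvge (c n) M)).

Definition hyperD (j : nat) (p : {poly F}) : {poly F} := p^`N(j).

(* extension by continuity: the m-th coordinate of D_j(x) is the eventual
   value of D_j(x_n) mod pi^m, since x_n -> x pi-adically *)
Definition Dext (j : nat) (x : Oseq) : Oseq := fun m =>
  xget 0 [set p | exists N, forall n, (N <= n)%N -> hyperD j (x n) %% pi ^+ m = p].

Definition DextK (j : nat) : Ofun := fun x => KofO (Dext j x).

Definition digitQ (j i : nat) : nat := ((i %/ Qpi ^ j) %% Qpi)%N.
Definition digitExt (e : nat -> Ofun) (i : nat) : Ofun := fun t =>
  Kprod i (fun j => Kpow (e j t) (digitQ j i)).

End PiAdic.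

(* Main.v *)
(** Write k for the residue field and Q for its cardinal.  Since pi divides T^Q - T,
    the derivative pi' is a unit modulo pi, and Leibniz' rule gives
    D_j (pi^n g) = 0 for j < n and D_n (pi^n g) = pi'^n g modulo pi.
    By this triangularity p |-> (D_0 p, ..., D_(n-1) p) mod pi is a bijection from
    F[T]/pi^n onto k^n.  Hence the D_j with j < n form a basis of the k-linear maps
    F[T]/pi^n -> k, while the digit products become the monomials of degree < Q in each
    variable on k^n, which form a basis of all functions k^n -> k (independence by
    counting roots, spanning by counting functions).

    Dividing by pi repeatedly, a uniformly continuous function modulo pi^N has a unique
    finite expansion modulo pi^N; by uniqueness these coefficients are compatible in N,
    so they are the coordinates of elements of O.  Finally, by compactness of O a
    continuous function O -> K is bounded and uniformly continuous, hence is determined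
    modulo each pi^N by its values on polynomials. *)

Require Import Defs.
From mathcomp Require Import all_boot all_order all_algebra all_field.
From mathcomp Require Import boolp classical_sets.
From mathcomp Require Import zify ring.
Set Implicit Arguments. Unset Strict Implicit. Unset Printing Implicit Defensive.
Import GRing.Theory.
Local Open Scope ring_scope.

(** * Hyperderivatives of polynomials *)

Lemma nderivnMX (R : nzSemiRingType) (p : {poly R}) n :
  (p * 'X)^`N(n.+1) = p^`N(n) + p^`N(n.+1) * 'X.
Proof. by have := nderivnMXaddC n p 0; rewrite addr0. Qed.

Lemma nderivnM (R : comNzRingType) (p q : {poly R}) n :
  (p * q)^`N(n) = \sum_(i < n.+1) p^`N(i) * q^`N(n - i).
Proof.
elim/poly_ind: p n => [|p c IH] n.
  by rewrite mul0r linear0 big1 // => i _; rewrite linear0 mul0r.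
have CM r m : (c%:P * r)^`N(m) = c%:P * r^`N(m) by rewrite !mul_polyC linearZ.
case: n => [|n]; first by rewrite big_ord1 subnn !nderivn0.
rewrite mulrDl nderivnD CM mulrAC nderivnMX !IH.
rewrite [RHS]big_ord_recl /= subn0 nderivn0.
under [X in _ = _ + X]eq_bigr => i _.
  rewrite /bump /= add1n nderivnMXaddC mulrDl subSS; over.
rewrite big_split /= [in X in _ + X * 'X]big_ord_recl /= subn0 nderivn0.
under [in X in _ + X * 'X]eq_bigr => i _ do rewrite /bump /= add1n subSS.
rewrite [in LHS]mulrDl mulr_suml mulrDl.
under [X in _ + (_ + X) + _]eq_bigr => i _ do rewrite mulrAC.
by rewrite [p * 'X * _]mulrAC; ring.
Qed.

(** If [p] did not divide the binomial, [p ^ k] would be coprime to it, and the identity [j * 'C(p ^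
    k, j) = p ^ k * 'C(p ^ k - 1, j - 1)] would force [p ^ k] to divide [j]. *)
Lemma prime_dvd_binX p k j : prime p -> (0 < j < p ^ k)%N -> (p %| 'C(p ^ k, j))%N.
Proof.
move=> pp /andP[j0 jk]; apply/negPn/negP => npC.
have cop : coprime (p ^ k) 'C(p ^ k, j) by apply: coprimeXl; rewrite prime_coprime.
have : (p ^ k %| j)%N.
  rewrite -(Gauss_dvdl j cop); case: j j0 {jk npC cop} => // j _.
  by rewrite -mul_bin_diag dvdn_mulr.
by move/(dvdn_leq j0); rewrite leqNgt jk.
Qed.

Lemma pnat_card_finField (F : finFieldType) : [pchar F].-nat #|F|.
Proof.
have [p pp pF] := finPcharP F.
have := pprimeChar_pgroup pF; rewrite /pgroup.pgroup cardsT.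
by rewrite (eq_pnat _ (pcharf_eq pF)).
Qed.

(** This is the source of linearity over the coefficient field, whose elements are limits of powers
    [a ^+ (Q ^ m)]. Frobenius splits the [q]-th power of [u * 'X + c], which reduces the claim to
    the factor ['X^q]. *)
Lemma nderivn_pX (F : finFieldType) (u x : {poly F}) q j :
  [pchar F].-nat q -> (j < q)%N -> (u ^+ q * x)^`N(j) = u ^+ q * x^`N(j).
Proof.
move=> qF jq; have [p pp pF] := finPcharP F.
have qP : [pchar {poly F}].-nat q by rewrite (eq_pnat _ (pchar_poly _)).
have [k qE] : exists k, q = (p ^ k)%N.
  by exists (logn p q); rewrite -p_part part_pnat_id // -(eq_pnat _ (pcharf_eq pF)).
(* In Leibniz' rule every term but the first carries some ['C(q, l)] with [0 < l < q], which
   vanishes in [F]. *)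
have XqM (y : {poly F}) i : (i < q)%N -> ('X^q * y)^`N(i) = 'X^q * y^`N(i).
  move=> iq; rewrite nderivnM big_ord_recl /= nderivn0 subn0 big1 ?addr0 // => l _.
  have pP : p \in [pchar {poly F}] by rewrite pchar_poly.
  have: (p %| 'C(q, l.+1))%N by rewrite qE prime_dvd_binX //= -qE; have := ltn_ord l; lia.
  by rewrite (dvdn_pcharf pP) => /eqP C0; rewrite nderivnXn -mulr_natr /bump /= add1n C0 mulr0 mul0r.
elim/poly_ind: u x => [|u c IH] x.
  by rewrite expr0n; case: q jq {qF qP qE XqM} => // q _; rewrite !mul0r linear0.
rewrite exprDn_pchar // exprMn_comm ?mulrDl; last exact: commr_polyX.
rewrite nderivnD -mulrA IH XqM // -rmorphXn /= !mul_polyC linearZ /=.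
by rewrite mulrA.
Qed.

(** * Congruences modulo powers of [pi], and the effect of hyperderivatives on them *)

Section Modulus.
Variables (F : finFieldType) (pi : {poly F}).

Definition eqm N (p q : {poly F}) := pi ^+ N %| p - q.

Lemma eqmm N p : eqm N p p. Proof. by rewrite /eqm subrr dvdp0. Qed.
Lemma eqm_sym N p q : eqm N p q = eqm N q p.
Proof. by rewrite /eqm -dvdpNr opprB. Qed.
Lemma eqm_trans N q p r : eqm N p q -> eqm N q r -> eqm N p r.
Proof.
rewrite /eqm => pq qr; rewrite (_ : p - r = p - q + (q - r)); last by ring.
exact: dvdp_add.
Qed.
Lemma eqmD N p q r s : eqm N p q -> eqm N r s -> eqm N (p + r) (q + s).
Proof. by rewrite /eqm => pq rs; rewrite opprD addrACA dvdp_add. Qed.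
Lemma eqmN N p q : eqm N p q -> eqm N (- p) (- q).
Proof. by rewrite /eqm -opprD dvdpNr. Qed.
Lemma eqmM N p q r s : eqm N p q -> eqm N r s -> eqm N (p * r) (q * s).
Proof.
rewrite /eqm => pq rs.
rewrite (_ : p * r - q * s = (p - q) * r + q * (r - s)); last by ring.
by apply: dvdp_add; [apply: dvdp_mulr|apply: dvdp_mull].
Qed.
Lemma eqmX N p q k : eqm N p q -> eqm N (p ^+ k) (q ^+ k).
Proof. by move=> H; elim: k => [|k IH]; rewrite ?eqmm // !exprS eqmM. Qed.
Lemma eqm_sum N I (r : seq I) (P : pred I) (p q : I -> {poly F}) :
  (forall i, P i -> eqm N (p i) (q i)) ->
  eqm N (\sum_(i <- r | P i) p i) (\sum_(i <- r | P i) q i).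
Proof. by move=> H; elim/big_ind2: _ => // [|*]; [exact: eqmm|exact: eqmD]. Qed.
Lemma eqm_prod N I (r : seq I) (P : pred I) (p q : I -> {poly F}) :
  (forall i, P i -> eqm N (p i) (q i)) ->
  eqm N (\prod_(i <- r | P i) p i) (\prod_(i <- r | P i) q i).
Proof. by move=> H; elim/big_ind2: _ => // [|*]; [exact: eqmm|exact: eqmM]. Qed.
Lemma eqm_le N M p q : (N <= M)%N -> eqm M p q -> eqm N p q.
Proof. by move=> NM; apply: dvdp_trans; apply: dvdp_exp2l. Qed.
Lemma eqm0 N p : eqm N p 0 = (pi ^+ N %| p). Proof. by rewrite /eqm subr0. Qed.
Lemma eqm_exp0 p q : eqm 0 p q. Proof. by rewrite /eqm expr0 dvd1p. Qed.
Lemma eqmP N p q : reflect (p %% pi ^+ N = q %% pi ^+ N) (eqm N p q).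
Proof.
apply: (iffP eqP) => [|H]; rewrite modpD modpN; last by rewrite H subrr.
by move/eqP; rewrite subr_eq0 => /eqP.
Qed.
Lemma eqm_mod N p : eqm N (p %% pi ^+ N) p.
Proof. by apply/eqmP; rewrite modp_id. Qed.
(** A hyperderivative of order [j] loses at most [j] factors [pi]: in Leibniz' rule for
    [pi * (pi ^+ n * g)], either [pi] is left intact, or a positive part of the order falls on it
    and less than [j] remains for the other factor. *)
Lemma hyperD_dvd n j g : pi ^+ (n - j) %| (pi ^+ n * g)^`N(j).
Proof.
elim: n j => [|n IH] j; first by rewrite sub0n expr0 dvd1p.
rewrite exprS -mulrA nderivnM; apply: (big_ind (fun r => pi ^+ (n.+1 - j) %| r)).
- exact: dvdp0.
- by move=> *; apply: dvdp_add.
move=> [[|i] /= ij] _.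
  rewrite nderivn0 subn0; apply: (dvdp_trans (dvdp_exp2l _ (_ : _ <= (n - j).+1)%N)); first lia.
  by rewrite exprS dvdp_mul.
apply/dvdp_mull/(dvdp_trans _ (IH _)); apply: dvdp_exp2l; lia.
Qed.

Lemma hyperD_eqm N j p q : eqm (N + j) p q -> eqm N (hyperD j p) (hyperD j q).
Proof.
rewrite /eqm /hyperD -nderivnB => /dvdpP [g ->]; rewrite mulrC.
by have := hyperD_dvd (N + j) j g; rewrite addnK.
Qed.

End Modulus.

(** * Reduction modulo pi *)

Section Residue.
Variables (F : finFieldType) (pi : {poly F}).
Hypothesis pi_irr : irreducible_poly pi.

Lemma pi_neq0 : pi != 0.
Proof. by rewrite -size_poly_gt0 (leq_trans _ pi_irr.1). Qed.

Lemma residue_field : exists (k : finFieldType) (rho : {rmorphism {poly F} -> k}),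
  [/\ #|k| = Qpi pi, forall p, (rho p == 0) = (pi %| p) & forall y, exists p, rho p = y].
Proof.
have l0 : (lead_coef pi)^-1 != 0 by rewrite invr_eq0 lead_coef_eq0 pi_neq0.
(* The quotient is formed modulo a monic polynomial, so [pi] is replaced by its monic associate. *)
pose h := (lead_coef pi)^-1 *: pi.
have hpi : h %= pi by rewrite eqp_scale.
have hM : h \is monic by rewrite monicE lead_coefZ mulVf // lead_coef_eq0 pi_neq0.
have hsz : size h = size pi by rewrite size_scale.
have hI : irreducible_poly h.
  split=> [|q sq]; first by rewrite hsz pi_irr.1.
  rewrite (eqp_dvdr _ hpi) => qh; apply: eqp_trans (pi_irr.2 q sq qh) _.
  by rewrite eqp_sym.
have hMI : monic_irreducible_poly h by [].
have hE := mk_monicE hMI.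
exists {poly %/ h with hMI}, (in_qpoly h : {rmorphism _ -> {poly %/ h}}); split.
- by rewrite card_qfpoly hsz.
- move=> p; rewrite -(eqp_dvdl _ hpi) -val_eqE /= hE.
  by rewrite /dvdp modpE (monicP hM) expr1n invr1 scale1r.
- move=> y; exists (val (y : {poly %/ h})); apply: val_inj; apply: in_qpoly_small; exact: size_mk_monic.
Qed.

End Residue.

(** * Functions on [k^n] and the monomials indexed by base [Q] digits *)

Section DigitMonomials.
Variable k : finFieldType.
Let Q := #|k|.

Definition digit j i := ((i %/ Q ^ j) %% Q)%N.

Definition digit_mon n (v : nat -> k) i := \prod_(j < n) v j ^+ digit j i.

Let Q_gt1 : (1 < Q)%N. Proof. exact: finNzRing_gt1. Qed.

Lemma digit_small i j : (i < Q ^ j)%N -> digit j i = 0%N.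
Proof. by move=> ij; rewrite /digit divn_small // mod0n. Qed.

Lemma digit_split n a b j : (j < n)%N -> digit j (b + a * Q ^ n) = digit j b.
Proof.
move=> jn; rewrite /digit -(subnK (ltnW jn)) expnD mulnA addnC divnMDl ?expn_gt0 ?(ltnW Q_gt1) //.
by rewrite -(subnSK jn) expnS mulnCA -modnDml modnMr.
Qed.

Lemma digit_top n a b : (b < Q ^ n)%N -> (a < Q)%N -> digit n (b + a * Q ^ n) = a.
Proof.
move=> bn aQ; rewrite /digit addnC divnMDl ?expn_gt0 ?(ltnW Q_gt1) //.
by rewrite divn_small // addn0 modn_small.
Qed.

Lemma digit_mon_split n a b v : (b < Q ^ n)%N -> (a < Q)%N ->
  digit_mon n.+1 v (b + a * Q ^ n) = digit_mon n v b * v n ^+ a.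
Proof.
move=> bn aQ; rewrite /digit_mon big_ord_recr /= digit_top //; congr (_ * _).
by apply: eq_bigr => j _; rewrite digit_split.
Qed.

(** A nonzero polynomial of degree less than [Q] has fewer than [Q] roots, whereas this one vanishes
    on all of [k]. *)
Lemma poly_fun_eq0 (c : nat -> k) :
  (forall y, \sum_(0 <= a < Q) c a * y ^+ a = 0) -> forall a, (a < Q)%N -> c a = 0.
Proof.
move=> c0 a aQ; pose p := \poly_(a < Q) c a.
have p0 : p = 0.
  apply/eqP/negP => /negP pN0.
  have /(max_poly_roots pN0)/(_ (enum_uniq k)) : all (root p) (enum k).
    by apply/allP => y _; rewrite /root horner_poly -(big_mkord xpredT (fun a => c a * y ^+ a)) c0.
  by rewrite -cardE ltnNge size_poly.
by have := coef_poly Q c a; rewrite aQ -/p p0 coef0.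
Qed.

(** Induction on the number of variables: once the top digit [a] is split off, the sum is a
    polynomial of degree less than [Q] in the last variable, with coefficients of the same shape in
    the other variables. *)
Lemma digit_mon_free n (c : nat -> k) :
  (forall v, \sum_(0 <= i < Q ^ n) c i * digit_mon n v i = 0) ->
  forall i, (i < Q ^ n)%N -> c i = 0.
Proof.
elim: n c => [|n IH] c c0 i.
  rewrite expn0 ltnS leqn0 => /eqP ->.
  by have := c0 (fun _ => 0); rewrite expn0 big_nat1 /digit_mon big_ord0 mulr1.
move=> iQ; rewrite (divn_eq i (Q ^ n)) addnC.
have aQ : (i %/ Q ^ n < Q)%N by rewrite ltn_divLR ?expn_gt0 ?(ltnW Q_gt1) // -expnS.
apply: (IH (fun b => c (b + i %/ Q ^ n * Q ^ n)%N)); last by rewrite ltn_mod expn_gt0 (ltnW Q_gt1).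
move=> v; apply: (poly_fun_eq0 (c := fun a => \sum_(0 <= b < Q ^ n) c (b + a * Q ^ n)%N * digit_mon n v b)) aQ.
(* The test point keeps [v] below [n] and takes the value [y] at [n]. *)
move=> y; rewrite -[RHS](c0 (fun j => if (j < n)%N then v j else y)).
rewrite expnS big_nat_mul; apply: eq_big_nat => a /= aQ.
rewrite -{2}[(a * Q ^ n)%N]add0n big_addn mulSn addnK mulr_suml; apply: eq_big_nat => b /= bQ.
rewrite digit_mon_split // ltnn -mulrA; congr (_ * (_ * _)).
by apply: eq_bigr => j _; rewrite ltn_ord.
Qed.

(** Freeness makes [Phi] injective, and its source and target both have [Q ^ (Q ^ n)] elements. *)
Lemma digit_mon_span n (psi : n.-tuple k -> k) : exists c : nat -> k,
  forall w, psi w = \sum_(0 <= i < Q ^ n) c i * digit_mon n (nth 0 w) i.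
Proof.
pose Phi (c : {ffun 'I_(Q ^ n) -> k}) :=
  [ffun w : n.-tuple k => \sum_(i < Q ^ n) c i * digit_mon n (nth 0 w) i].
pose ext (c : {ffun 'I_(Q ^ n) -> k}) i := if insub i is Some j then c j else 0.
have extE c (i : 'I_(Q ^ n)) : ext c i = c i by rewrite /ext valK.
have PhiE c w : Phi c w = \sum_(0 <= i < Q ^ n) ext c i * digit_mon n (nth 0 w) i.
  by rewrite ffunE big_mkord; apply: eq_bigr => i _; rewrite extE.
have inj : injective Phi.
  move=> c1 c2 /ffunP c12; apply/ffunP => i; rewrite -!extE; apply/eqP; rewrite -subr_eq0; apply/eqP.
  apply: (@digit_mon_free n (fun i => ext c1 i - ext c2 i)) (ltn_ord i) => v.
  have := c12 [tuple of mkseq v n]; rewrite !PhiE => /eqP; rewrite -subr_eq0 -sumrB => /eqP {2}<-.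
  apply: eq_bigr => j _; rewrite -mulrBl; congr (_ * _).
  by apply: eq_bigr => l _; rewrite nth_mkseq.
have /codomP [c cE] : [ffun w => psi w] \in codom Phi.
  by apply: (inj_card_onto inj); rewrite !card_ffun card_tuple card_ord leqnn.
by exists (ext c) => w; rewrite -PhiE -cE ffunE.
Qed.

End DigitMonomials.

(** * Hyperderivatives with values in the residue field *)

Section ResidueHyper.
Variables (F : finFieldType) (pi : {poly F}) (k : finFieldType).
Variable rho : {rmorphism {poly F} -> k}.
Hypothesis rho0 : forall p, (rho p == 0) = (pi %| p).
Hypothesis rho_surj : forall y, exists p, rho p = y.

Lemma rho_eqm p q : (rho p == rho q) = eqm pi 1 p q.
Proof. by rewrite -subr_eq0 -rmorphB rho0 /eqm expr1. Qed.

Lemma rho_deriv_neq0 : rho pi^`() != 0.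
Proof.
apply/negP => dpi.
have : pi %| 'X^#|k| - 'X by rewrite -rho0 rmorphB rmorphXn expf_card subrr.
move=> /dvdpP [w] /(congr1 (fun p => rho p^`())).
rewrite derivM derivB derivXn derivX rmorphB rmorphMn rmorph1 rmorphD !rmorphM.
rewrite (eqP dpi) mulr0 addr0.
have /eqP -> : rho pi == 0 by rewrite rho0.
rewrite mulr0.
(* Translation by [y] permutes [k], so the sum of all elements is unchanged when [y] is added to
   each of them. *)
have -> y : y *+ #|k| = 0 :> k.
  apply: (@addIr _ (\sum_(x : k) x)); rewrite add0r -[y *+ _]sumr_const -big_split /=.
  by rewrite [RHS](reindex_inj (addrI y)).
by move/eqP; rewrite sub0r oppr_eq0 oner_eq0.
Qed.

Definition rhoD j p := rho p^`N(j).

Lemma rhoD_eqm n j p q : (j < n)%N -> eqm pi n p q -> rhoD j p = rhoD j q.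
Proof.
move=> jn pq; apply/eqP; rewrite rho_eqm; apply: hyperD_eqm.
by apply: eqm_le pq; rewrite add1n.
Qed.

Lemma rhoDD j p q : rhoD j (p + q) = rhoD j p + rhoD j q.
Proof. by rewrite /rhoD nderivnD rmorphD. Qed.

Lemma rhoD_lt n j g : (j < n)%N -> rhoD j (pi ^+ n * g) = 0.
Proof.
move=> jn; apply/eqP; rewrite rho0; apply: dvdp_trans (hyperD_dvd pi n j g).
by rewrite dvdp_exp // subn_gt0.
Qed.

Lemma rhoD_diag n g : rhoD n (pi ^+ n * g) = rho pi^`() ^+ n * rho g.
Proof.
elim: n => [|n IH]; first by rewrite /rhoD !expr0 !mul1r nderivn0.
have pi0 : rho pi = 0 by apply/eqP; rewrite rho0.
rewrite exprS -mulrA /rhoD nderivnM big_ord_recl big_ord_recl /= nderivn0 nderivn1 subn0 !rmorphD !rmorphM.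
rewrite pi0 mul0r add0r subSS subn0 -/(rhoD n _) IH rmorph_sum big1 ?addr0.
  by rewrite exprS mulrA.
move=> i _; rewrite rmorphM /= -/(rhoD _ (pi ^+ n * g)) rhoD_lt ?mulr0 // /bump /=.
have := ltn_ord i; lia.
Qed.

Lemma rhoD_inj n p : (forall j, (j < n)%N -> rhoD j p = 0) -> pi ^+ n %| p.
Proof.
elim: n => [|n IH] H; first by rewrite expr0 dvd1p.
have /dvdpP [g pE] : pi ^+ n %| p by apply: IH => j jn; apply: H; rewrite ltnS ltnW.
have /eqP := H n (ltnSn n); rewrite pE mulrC rhoD_diag mulf_eq0 expf_eq0 (negbTE rho_deriv_neq0) andbF /=.
by rewrite rho0 => ?; rewrite exprS mulrC dvdp_mul.
Qed.

(** Triangular solving: adding [pi ^+ n * g] leaves the orders below [n] unchanged and shifts order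
    [n] by a unit times [rho g]. *)
Lemma rhoD_surj n (v : nat -> k) : exists p, forall j, (j < n)%N -> rhoD j p = v j.
Proof.
elim: n => [|n [p pv]]; first by exists 0.
have [g gE] := rho_surj ((v n - rhoD n p) / rho pi^`() ^+ n).
exists (p + pi ^+ n * g) => j; rewrite ltnS leq_eqVlt => /predU1P [->|jn]; rewrite rhoDD.
  by rewrite rhoD_diag gE mulrC divfK ?expf_neq0 ?rho_deriv_neq0 // addrC subrK.
by rewrite rhoD_lt // addr0 pv.
Qed.

Lemma fun_span n (phi : {poly F} -> k) :
  (forall p q, eqm pi n p q -> phi p = phi q) ->
  exists c : nat -> k, forall p,
    phi p = \sum_(0 <= i < #|k| ^ n) c i * digit_mon n (rhoD^~ p) i.
Proof.
move=> phiE.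
(* Choosing a polynomial [P w] with prescribed residues [w] turns [phi] into a function on [k^n]. *)
have [P PE] := choice (fun w : n.-tuple k => rhoD_surj n (nth 0 w)).
have [c cE] := digit_mon_span (fun w => phi (P w)).
exists c => p; pose w := [tuple of mkseq (rhoD^~ p) n].
have wE j : (j < n)%N -> nth 0 w j = rhoD j p by move=> jn; rewrite nth_mkseq.
rewrite (phiE p (P w)) ?cE.
  apply: eq_bigr => i _; congr (_ * _); apply: eq_bigr => j _; congr (_ ^+ _).
  by rewrite wE.
apply: rhoD_inj => j jn; rewrite rhoDD /rhoD nderivnN rmorphN -!/(rhoD _ _) PE // wE //.
by rewrite subrr.
Qed.

Lemma fun_free n (c : nat -> k) :
  (forall p, \sum_(0 <= i < #|k| ^ n) c i * digit_mon n (rhoD^~ p) i = 0) ->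
  forall i, (i < #|k| ^ n)%N -> c i = 0.
Proof.
move=> H; apply: digit_mon_free => v; have [p pv] := rhoD_surj n v.
rewrite -[RHS](H p); apply: eq_bigr => i _; congr (_ * _).
by apply: eq_bigr => j _; rewrite pv.
Qed.

Hypothesis card_k : #|k| = Qpi pi.

Lemma rho_X a m : rho (a ^+ (Qpi pi ^ m)) = rho a.
Proof.
rewrite rmorphXn /= -card_k; elim: m => [|m IH]; first by rewrite expn0 expr1.
by rewrite expnSr exprM IH expf_card.
Qed.

(** As [a ^+ (Q ^ m)] has residue [rho a], this expresses [k]-linearity on polynomials. Only large
    [m] are considered because [D_n] commutes with [Q ^ m]-th powers once [n < Q ^ m]. *)
Definition rho_linear (phi : {poly F} -> k) :=
  (forall p q, phi (p + q) = phi p + phi q) /\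
  exists m0, forall m, (m0 <= m)%N -> forall a p, phi (a ^+ (Qpi pi ^ m) * p) = rho a * phi p.

Lemma pnat_QpiX m : [pchar F].-nat (Qpi pi ^ m)%N.
Proof. by rewrite pnatX pnatX pnat_card_finField. Qed.

Lemma ltn_QpiX m : (m < Qpi pi ^ m)%N.
Proof. by apply: ltn_expl; rewrite -card_k finNzRing_gt1. Qed.

Lemma rhoD_linear n : rho_linear (rhoD n).
Proof.
split=> [p q|]; first exact: rhoDD.
exists n => m nm a p; rewrite /rhoD nderivn_pX ?pnat_QpiX ?rmorphM ?rho_X //.
exact: leq_ltn_trans nm (ltn_QpiX m).
Qed.

(** Subtracting the multiple of [rhoD n] that agrees with [phi] at [pi ^+ n] leaves a linear map
    that depends only on the argument modulo [pi ^+ n]. *)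
Lemma lin_span n (phi : {poly F} -> k) :
  (forall p q, eqm pi n p q -> phi p = phi q) -> rho_linear phi ->
  exists c : nat -> k, forall p, phi p = \sum_(0 <= i < n) c i * rhoD i p.
Proof.
elim: n phi => [|n IH] phi phiE phiL.
  exists (fun _ => 0) => p; rewrite big_nil (phiE p 0) ?eqm_exp0 //.
  by apply: (@addrI _ (phi 0)); rewrite -phiL.1 !addr0.
pose b := phi (pi ^+ n) / rho pi^`() ^+ n.
pose psi p := phi p - b * rhoD n p.
have psiD p q : psi (p + q) = psi p + psi q.
  by rewrite /psi phiL.1 rhoDD; ring.
have psi0 : psi (pi ^+ n) = 0.
  have := rhoD_diag n 1; rewrite mulr1 rmorph1 mulr1 => Dn.
  by rewrite /psi Dn divfK ?expf_neq0 ?rho_deriv_neq0 // subrr.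
have psiE p q : eqm pi n.+1 p q -> psi p = psi q.
  by move=> pq; rewrite /psi (phiE _ _ pq) (rhoD_eqm _ pq).
have psi00 : psi 0 = 0 by apply: (@addrI _ (psi 0)); rewrite -psiD !addr0.
have psiL : rho_linear psi.
  split => //; have [m1 h1] := phiL.2; have [m2 h2] := (rhoD_linear n).2.
  exists (maxn m1 m2) => m; rewrite geq_max => /andP [m1m m2m] a p.
  by rewrite /psi h1 // h2 //; ring.
(* Modulo [pi], [g] is its own [Q ^ m0]-th power, which linearity pulls out of [psi], leaving the
   factor [psi (pi ^+ n) = 0]. The error term is a multiple of [pi ^+ n.+1]. *)
have psi_kill g : psi (pi ^+ n * g) = 0.
  have [m0 /(_ m0 (leqnn _)) mE] := psiL.2.
  have : eqm pi 1 g (g ^+ (Qpi pi ^ m0)) by rewrite -rho_eqm rho_X.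
  rewrite /eqm expr1 => /dvdpP [h /(canRL (subrK _)) ->].
  rewrite mulrDr psiD [X in _ + psi X]mulrC mE psi0 mulr0 addr0.
  by rewrite (psiE _ 0) // eqm0 exprSr mulrCA dvdp_mull.
have {}psiE p q : eqm pi n p q -> psi p = psi q.
  rewrite /eqm => /dvdpP [h /(canRL (subrK _)) ->].
  by rewrite psiD mulrC psi_kill add0r.
have [c cE] := IH psi psiE psiL.
exists (fun i => if (i < n)%N then c i else b) => p.
rewrite big_nat_recr //= ltnn -[LHS](subrK (b * rhoD n p)) -/(psi p) cE.
by congr (_ + _); apply: eq_big_nat => i /andP [_ ->].
Qed.

Lemma lin_free n (c : nat -> k) :
  (forall p, \sum_(0 <= i < n) c i * rhoD i p = 0) ->
  forall i, (i < n)%N -> c i = 0.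
Proof.
move=> H i iN; have [p pv] := rhoD_surj n (fun j => (j == i)%:R).
rewrite -(H p) big_mkord (bigD1 (Ordinal iN)) //= pv // eqxx mulr1 big1 ?addr0 // => j ji.
by rewrite pv // (_ : (j == i :> nat) = false) ?mulr0 //; apply: negbTE.
Qed.

End ResidueHyper.

(** * Expansions modulo powers of pi *)

Lemma big_supp (R : nzRingType) m M (c G : nat -> R) :
  (forall i, (m <= i)%N -> c i = 0) -> (m <= M)%N ->
  \sum_(0 <= i < M) c i * G i = \sum_(0 <= i < m) c i * G i.
Proof.
move=> c0 mM; rewrite (big_cat_nat (n := m)) //= [X in _ + X]big_nat_cond [X in _ + X]big1 ?addr0 // => i.
by rewrite andbT => /andP [mi _]; rewrite c0 // mul0r.
Qed.

Section Expansion.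
Variables (F : finFieldType) (pi : {poly F}).
Hypothesis pi_n0 : pi != 0.
Variables (g : nat -> {poly F} -> {poly F}) (E : nat -> ({poly F} -> {poly F}) -> Prop).
Local Notation sum_g c m p := (\sum_(0 <= i < m) c i * g i p).
Local Notation eqm := (eqm pi).

(* [E N phi] says that [phi], read modulo [pi ^+ N], belongs to the class. *)
Record expansion_class := ExpansionClass {
  class_basis : forall N i, E N (g i);
  class_add : forall N phi psi, E N phi -> E N psi -> E N (fun p => phi p + psi p);
  class_scale : forall N a phi, E N phi -> E N (fun p => a * phi p);
  class_le : forall N phi, E N.+1 phi -> E N phi;
  class_div : forall N phi, E N.+1 (fun p => pi ^+ N * phi p) -> E 1 phi;
  class_span : forall phi, E 1 phi -> exists c m,
    (forall i, (m <= i)%N -> c i = 0) /\ forall p, eqm 1 (phi p) (sum_g c m p);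
  class_free : forall c m, (forall p, eqm 1 (sum_g c m p) 0) ->
    forall i, (i < m)%N -> eqm 1 (c i) 0 }.

Hypothesis HE : expansion_class.

Lemma class_sum N c m phi : E N phi -> E N (fun p => phi p + sum_g c m p).
Proof.
move=> phiE; elim: m => [|m IH].
  by rewrite (_ : (fun _ => _) = phi) //; apply/funext => p; rewrite big_nil addr0.
rewrite (_ : (fun _ => _) = fun p => phi p + sum_g c m p + c m * g m p).
  by apply: class_add => //; apply: class_scale => //; apply: class_basis.
by apply/funext => p; rewrite big_nat_recr //= addrA.
Qed.

(** Successive approximation: the remainder modulo [pi ^+ N] is divided by [pi ^+ N], the quotient
    is expanded modulo [pi], and its coefficients times [pi ^+ N] correct the previous ones. *)
Lemma expansion_exists N phi : E N phi -> exists c m,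
  (forall i, (m <= i)%N -> c i = 0) /\ forall p, eqm N (phi p) (sum_g c m p).
Proof.
elim: N phi => [|N IH] phi phiE.
  by exists (fun _ => 0), 0%N; split => // p; exact: eqm_exp0.
have [c [m [c0 cE]]] := IH phi (class_le HE phiE).
pose psi p := (phi p - sum_g c m p) %/ pi ^+ N.
have psiE p : phi p - sum_g c m p = pi ^+ N * psi p.
  by rewrite mulrC divpK //; exact: cE.
have /(class_span HE) [c' [m' [c'0 c'E]]] : E 1 psi.
  apply: (class_div HE (N := N)).
  rewrite (_ : (fun _ => _) = fun p => phi p + sum_g (fun i => - c i) m p); first exact: class_sum.
  apply/funext => p; rewrite -psiE -sumrN; congr (_ + _).
  by apply: eq_bigr => i _; rewrite mulNr.
exists (fun i => c i + pi ^+ N * c' i), (maxn m m'); split=> [i|p].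
  by rewrite geq_max => /andP [mi m'i]; rewrite c0 // c'0 // mulr0 addr0.
rewrite -[phi p](subrK (sum_g c m p)) psiE addrC.
rewrite -(big_supp _ c0 (leq_maxl m m')).
under [X in eqm _ _ X]eq_bigr => i _ do rewrite mulrDl -mulrA.
rewrite big_split /= -mulr_sumr (big_supp _ c'0 (leq_maxr m m')).
apply: eqmD; first exact: eqmm.
by rewrite /eqm -mulrBr exprSr dvdp_mul2l ?expf_neq0 // -[pi]expr1; exact: c'E.
Qed.

(** Freeness modulo [pi] shows that all coefficients are divisible by [pi]. Dividing them by [pi]
    lowers [N] by one. *)
Lemma expansion_free N c m : (forall p, eqm N (sum_g c m p) 0) ->
  forall i, (i < m)%N -> eqm N (c i) 0.
Proof.
elim: N c => [|N IH] c c0 i im; first exact: eqm_exp0.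
have c1 j : (j < m)%N -> eqm 1 (c j) 0.
  by apply: (class_free HE) => p; apply: eqm_le (c0 p).
pose c' j := c j %/ pi.
have c'E j : (j < m)%N -> c j = pi * c' j.
  by move=> /c1; rewrite eqm0 expr1 => ?; rewrite mulrC divpK.
rewrite c'E // eqm0 exprS dvdp_mul2l // -eqm0; apply: IH im => p.
have := c0 p; rewrite !eqm0 -(dvdp_mul2l (pi ^+ N) _ pi_n0) -exprS mulr_sumr.
congr (_ %| _); apply: eq_big_nat => j /= jm; by rewrite c'E // mulrA.
Qed.

(** The lengths [m] and [m'] may differ because this compares expansions found at different
    precisions. *)
Lemma expansion_unique N c c' m m' :
  (forall i, (m <= i)%N -> c i = 0) -> (forall i, (m' <= i)%N -> c' i = 0) ->
  (forall p, eqm N (sum_g c m p) (sum_g c' m' p)) -> forall i, eqm N (c i) (c' i).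
Proof.
move=> c0 c'0 cc' i.
have [im|] := ltnP i (maxn m m'); last first.
  by rewrite geq_max => /andP [mi m'i]; rewrite c0 // c'0 // eqmm.
rewrite /eqm -(eqm0 _ N (c i - c' i)).
apply: (@expansion_free N (fun i => c i - c' i) (maxn m m')) im => p; rewrite eqm0.
under eq_bigr => j _ do rewrite mulrBl.
rewrite sumrB (big_supp _ c0 (leq_maxl _ _)) (big_supp _ c'0 (leq_maxr _ _)).
exact: cc'.
Qed.

End Expansion.

(** * Uniformly continuous maps and linear maps on polynomials as expansion classes *)

Section Classes.
Variables (F : finFieldType) (pi : {poly F}) (k : finFieldType).
Hypothesis pi_n0 : pi != 0.
Variable rho : {rmorphism {poly F} -> k}.
Hypothesis rho0 : forall p, (rho p == 0) = (pi %| p).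
Hypothesis rho_surj : forall y, exists p, rho p = y.
Hypothesis card_k : #|k| = Qpi pi.
Local Notation eqm := (eqm pi).

Definition ucont N (phi : {poly F} -> {poly F}) :=
  exists n, forall p q, eqm n p q -> eqm N (phi p) (phi q).

(* [a ^+ (Qpi pi ^ m)] agrees modulo [pi ^+ m] with the element of the coefficient field
   lifting the residue of [a]. *)
Definition ulin N (phi : {poly F} -> {poly F}) :=
  [/\ ucont N phi, forall p q, eqm N (phi (p + q)) (phi p + phi q) &
    exists m0, forall m, (m0 <= m)%N -> forall a p,
      eqm N (phi (a ^+ (Qpi pi ^ m) * p)) (a ^+ (Qpi pi ^ m) * phi p)].

Definition digitD i (p : {poly F}) :=
  \prod_(j < i) hyperD j p ^+ digitQ pi j i.

Lemma ucont_hyperD N i : ucont N (hyperD i).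
Proof. by exists (N + i)%N => p q; exact: hyperD_eqm. Qed.

Lemma ucont_add N phi psi : ucont N phi -> ucont N psi -> ucont N (fun p => phi p + psi p).
Proof.
move=> [n1 h1] [n2 h2]; exists (maxn n1 n2) => p q pq.
by apply: eqmD; [apply: h1|apply: h2]; apply: eqm_le pq; rewrite ?leq_maxl ?leq_maxr.
Qed.

Lemma ucont_mul N phi psi : ucont N phi -> ucont N psi -> ucont N (fun p => phi p * psi p).
Proof.
move=> [n1 h1] [n2 h2]; exists (maxn n1 n2) => p q pq.
by apply: eqmM; [apply: h1|apply: h2]; apply: eqm_le pq; rewrite ?leq_maxl ?leq_maxr.
Qed.

Lemma ucont_scale N a phi : ucont N phi -> ucont N (fun p => a * phi p).
Proof. by apply: ucont_mul; exists 0%N => p q _; exact: eqmm. Qed.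

Lemma ucont_digitD N i : ucont N (digitD i).
Proof.
exists (N + i)%N => p q pq; apply: eqm_prod => j _; apply: eqmX; apply: hyperD_eqm.
by apply: eqm_le pq; have := ltn_ord j; lia.
Qed.

Lemma ucont_le N phi : ucont N.+1 phi -> ucont N phi.
Proof. by move=> [n h]; exists n => p q /h; apply: eqm_le. Qed.

Lemma eqm_div N p q : eqm N.+1 (pi ^+ N * p) (pi ^+ N * q) -> eqm 1 p q.
Proof. by rewrite /eqm -mulrBr exprSr dvdp_mul2l ?expf_neq0. Qed.

Lemma digitQ_digit j i : digitQ pi j i = digit k j i.
Proof. by rewrite /digitQ /digit card_k. Qed.

(** Digits of [i] in positions [j] with [i < Q ^ j] are zero. As [i < Q ^ i], stopping the product
    at [i] or at [n] makes no difference. *)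
Lemma digit_mon_eq n (v : nat -> k) i : (i < #|k| ^ n)%N ->
  \prod_(j < i) v j ^+ digit k j i = digit_mon n v i.
Proof.
have H m M : (m <= M)%N -> (i < #|k| ^ m)%N ->
    \prod_(j < M) v j ^+ digit k j i = \prod_(j < m) v j ^+ digit k j i.
  move=> mM im; rewrite -!(big_mkord xpredT (fun j => v j ^+ digit k j i)).
  rewrite (big_cat_nat (n := m)) //= [X in _ * X]big_nat_cond [X in _ * X]big1 ?mulr1 // => j.
  rewrite andbT => /andP [mj _]; rewrite digit_small ?expr0 //.
  by apply: leq_trans im _; rewrite leq_pexp2l // ltnW // finNzRing_gt1.
have ii : (i < #|k| ^ i)%N by apply/ltn_expl/finNzRing_gt1.
move=> iN; rewrite /digit_mon.
by have [/H->//|/ltnW/H->] := leqP i n.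
Qed.

Lemma rho_digitD n i p : (i < #|k| ^ n)%N -> rho (digitD i p) = digit_mon n ((rhoD rho)^~ p) i.
Proof.
move=> iN; rewrite -(digit_mon_eq _ iN) rmorph_prod; apply: eq_bigr => j _.
by rewrite rmorphXn digitQ_digit.
Qed.

Lemma rho_sum0 (c : nat -> {poly F}) (g : nat -> {poly F} -> {poly F}) m p :
  eqm 1 (\sum_(0 <= i < m) c i * g i p) 0 ->
  \sum_(0 <= i < m) rho (c i) * rho (g i p) = 0.
Proof.
rewrite -(rho_eqm rho0) rmorph0 rmorph_sum => /eqP s0.
by rewrite -[RHS]s0; apply: eq_bigr => i _; rewrite rmorphM.
Qed.

Lemma lift_sum (c : nat -> k) (g : nat -> {poly F} -> {poly F}) phi m :
  (forall p, rho (phi p) = \sum_(0 <= i < m) c i * rho (g i p)) ->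
  exists c' m, (forall i, (m <= i)%N -> c' i = 0) /\
    forall p, eqm 1 (phi p) (\sum_(0 <= i < m) c' i * g i p).
Proof.
move=> phiE; have [s sE] := choice rho_surj.
(* Setting the coefficients to zero from [m] on ensures finite support, whatever [s] lifts [c i]
   to. *)
exists (fun i => if (i < m)%N then s (c i) else 0), m; split=> [i|p].
  by rewrite leqNgt => /negbTE ->.
rewrite -(rho_eqm rho0) phiE rmorph_sum; apply/eqP/eq_big_nat => i /= im.
by rewrite im rmorphM sE.
Qed.

(** Modulo [pi], a uniformly continuous map is a function of finitely many residues [rhoD j p], so
    [fun_span] and [fun_free] apply. *)
Lemma digit_class : expansion_class pi digitD ucont.
Proof.
split.
- exact: ucont_digitD.
- exact: ucont_add.
- exact: ucont_scale.
- exact: ucont_le.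
- by move=> N phi [n h]; exists n => p q /h /eqm_div.
- move=> phi [n h].
  have [|c cE] := fun_span rho0 rho_surj (n := n) (phi := rho \o phi).
    by move=> p q /h; rewrite -(rho_eqm rho0) => /eqP.
  apply: (@lift_sum c _ _ (#|k| ^ n)) => p; rewrite [LHS]cE; apply: eq_big_nat => i /= iN.
  by rewrite (rho_digitD _ iN).
- move=> c m c0 i im; rewrite -(rho_eqm rho0) rmorph0; apply/eqP.
  (* Freeness is available for sums of [#|k| ^ m] terms, so the [m] given coefficients are padded
     with zeros. *)
  pose b j := if (j < m)%N then rho (c j) else 0.
  have mQ : (m < #|k| ^ m)%N by apply/ltn_expl/finNzRing_gt1.
  suff : b i = 0 by rewrite /b im.
  apply: (fun_free rho0 rho_surj (c := b) _ (ltn_trans im mQ)) => p.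
  rewrite (@big_supp _ m) ?(ltnW mQ) //; last by move=> j; rewrite /b leqNgt => /negbTE ->.
  rewrite -[RHS](rho_sum0 (c0 p)); apply: eq_big_nat => j /= jm.
  by rewrite /b jm (rho_digitD _ (ltn_trans jm mQ)).
Qed.

Lemma ulin_hyperD N i : ulin N (hyperD i).
Proof.
split; first exact: ucont_hyperD.
  by move=> p q; rewrite /hyperD nderivnD eqmm.
exists i => m im a p; rewrite /hyperD nderivn_pX ?eqmm // ?pnat_QpiX //.
exact: leq_ltn_trans im (ltn_QpiX card_k m).
Qed.

Lemma hyperD_class : expansion_class pi (@hyperD F) ulin.
Proof.
split.
- exact: ulin_hyperD.
- move=> N phi psi [c1 a1 [m1 h1]] [c2 a2 [m2 h2]]; split; first exact: ucont_add.
    by move=> p q; rewrite addrACA eqmD.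
  exists (maxn m1 m2) => m; rewrite geq_max => /andP [m1m m2m] a p.
  by rewrite mulrDr eqmD ?h1 ?h2.
- move=> N b phi [c1 a1 [m1 h1]]; split; first exact: ucont_scale.
    by move=> p q; rewrite -mulrDr eqmM ?eqmm.
  by exists m1 => m m1m a p; rewrite mulrCA eqmM ?eqmm ?h1.
- move=> N phi [c1 a1 [m1 h1]]; split; first exact: ucont_le.
    by move=> p q; apply: eqm_le (a1 p q).
  by exists m1 => m m1m a p; apply: eqm_le (h1 m m1m a p).
- move=> N phi [[n h] a1 [m1 h1]]; split; first by exists n => p q /h /eqm_div.
    by move=> p q; apply: (@eqm_div N); rewrite mulrDr.
  by exists m1 => m m1m a p; apply: (@eqm_div N); rewrite mulrCA h1.
- move=> phi [[n h] a1 [m1 h1]].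
  have [||c cE] := lin_span rho0 card_k (n := n) (phi := rho \o phi).
  + by move=> p q /h; rewrite -(rho_eqm rho0) => /eqP.
  + split=> [p q|]; first by apply/eqP; rewrite -rmorphD (rho_eqm rho0).
    exists m1 => m m1m a p; apply/eqP; rewrite -(rho_X rho card_k a m) -rmorphM.
    by rewrite (rho_eqm rho0) h1.
  by apply: (@lift_sum c _ _ n) => p; rewrite [LHS]cE.
- move=> c m c0 i im; rewrite -(rho_eqm rho0) rmorph0; apply/eqP.
  apply: (lin_free rho0 rho_surj (c := rho \o c)) im => p.
  exact: rho_sum0 (c0 p).
Qed.

End Classes.

(** * The completion and its fraction field *)

Section Completion.
Variables (F : finFieldType) (pi : {poly F}).
Hypothesis pi_n0 : pi != 0.
Local Notation eqm := (eqm pi).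
Local Notation Oelt := (Oelt pi).

Lemma Oelt_eqm x n m : Oelt x -> (n <= m)%N -> eqm n (x m) (x n).
Proof.
move=> [_ xS]; elim: m => [|m IH]; first by rewrite leqn0 => /eqP ->; rewrite eqmm.
rewrite leq_eqVlt => /predU1P [->|nm]; first exact: eqmm.
apply: eqm_trans (IH nm); apply: (@eqm_le _ _ n m) => //.
by apply/eqmP; rewrite xS -[X in _ = X %% _]xS modp_id.
Qed.

Lemma Oelt_eq x y n : Oelt x -> Oelt y -> eqm n (x n) (y n) -> x n = y n.
Proof. by move=> [xr _] [yr _] /eqmP; rewrite xr yr. Qed.

Lemma Oelt_eq_le x y n m : Oelt x -> Oelt y -> (n <= m)%N -> x m = y m -> x n = y n.
Proof.
move=> xO yO nm xy; apply: Oelt_eq => //; apply: (eqm_trans _ (Oelt_eqm yO nm)).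
by rewrite -xy eqm_sym; apply: Oelt_eqm.
Qed.

Lemma Oelt0 x : Oelt x -> x 0%N = 0.
Proof. by move=> [xr _]; rewrite -xr expr0 modp1. Qed.

(** The sequence need only be coherent up to congruence; the arithmetic operations, Teichmuller
    lifts and limit coefficients all enter O this way. *)
Lemma Oelt_mod (z : nat -> {poly F}) :
  (forall n, eqm n (z n.+1) (z n)) -> Oelt (fun n => z n %% pi ^+ n).
Proof.
move=> zE; split=> n; first exact: modp_id.
apply/eqmP/(eqm_trans _ (zE n)); apply: (eqm_le (leqnSn n)); exact: eqm_mod.
Qed.

Lemma Oof_elt p : Oelt (Oof pi p).
Proof. by apply: Oelt_mod => n; exact: eqmm. Qed.

Lemma OofE p n : eqm n (Oof pi p n) p.
Proof. exact: eqm_mod. Qed.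

Lemma Oadd_elt x y : Oelt x -> Oelt y -> Oelt (Oadd pi x y).
Proof. by move=> xO yO; apply: Oelt_mod => n; rewrite eqmD ?Oelt_eqm. Qed.

Lemma OaddE x y n : eqm n (Oadd pi x y n) (x n + y n).
Proof. exact: eqm_mod. Qed.

Lemma Omul_elt x y : Oelt x -> Oelt y -> Oelt (Omul pi x y).
Proof. by move=> xO yO; apply: Oelt_mod => n; rewrite eqmM ?Oelt_eqm. Qed.

Lemma OmulE x y n : eqm n (Omul pi x y n) (x n * y n).
Proof. exact: eqm_mod. Qed.

Lemma Oopp_elt x : Oelt x -> Oelt (Oopp pi x).
Proof. by move=> xO; apply: Oelt_mod => n; rewrite eqmN ?Oelt_eqm. Qed.

Lemma OoppE x n : eqm n (Oopp pi x n) (- x n).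
Proof. exact: eqm_mod. Qed.

Lemma Osub_elt x y : Oelt x -> Oelt y -> Oelt (Osub pi x y).
Proof. by move=> xO yO; apply/Oadd_elt/Oopp_elt. Qed.

Lemma OsubE x y n : eqm n (Osub pi x y n) (x n - y n).
Proof. by apply: eqm_trans (OaddE _ _ _) _; rewrite eqmD ?eqmm ?OoppE. Qed.

Lemma OpowE x m n : eqm n (Opow pi x m n) (x n ^+ m).
Proof.
elim: m => [|m IH]; first exact: OofE.
by apply: eqm_trans (OmulE _ _ _) _; rewrite exprSr eqmM ?eqmm.
Qed.

Lemma Oelt_eq0 x n : Oelt x -> (x n = 0) <-> eqm n (x n) 0.
Proof. by move=> [xr _]; split=> [->|/eqmP]; rewrite ?eqmm // xr mod0p. Qed.

Lemma Osub_eq0 x y n : Oelt x -> Oelt y -> (Osub pi x y n = 0) <-> (x n = y n).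
Proof.
move=> xO yO; split=> [s0|xy].
  by apply: Oelt_eq => //; rewrite /eqm -eqm0 -s0 eqm_sym OsubE.
apply/(Oelt_eq0 _ (Osub_elt xO yO)); apply: eqm_trans (OsubE _ _ _) _.
by rewrite xy subrr eqmm.
Qed.

(* [a = x / pi ^+ k] in K, with denominators cleared. *)
Definition is_frac (a : Kt F) k x :=
  [/\ Kelt pi a, Oelt x & forall n, eqm n (pi ^+ k * a.2 n) (pi ^+ a.1 * x n)].

Lemma frac_self a : Kelt pi a -> is_frac a a.1 a.2.
Proof. by move=> aK; split => // n; exact: eqmm. Qed.

Lemma frac_add a b k x y : is_frac a k x -> is_frac b k y -> is_frac (Kadd pi a b) k (Oadd pi x y).
Proof.
move=> [aK xO ax] [bK yO byy].
have H c z : Oelt z -> Oelt (Omul pi (Oof pi c) z) by move=> zO; apply/Omul_elt/zO/Oof_elt.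
split; [apply: Oadd_elt; exact: H|exact: Oadd_elt|] => n /=.
have HM c z : eqm n (Omul pi (Oof pi c) z n) (c * z n).
  by apply: eqm_trans (OmulE _ _ _) _; rewrite eqmM ?OofE ?eqmm.
apply: (@eqm_trans _ _ n (pi ^+ b.1 * (pi ^+ a.1 * x n) + pi ^+ a.1 * (pi ^+ b.1 * y n))); last first.
  rewrite exprD (_ : _ + _ = pi ^+ a.1 * pi ^+ b.1 * (x n + y n)); last by ring.
  by apply: eqmM; rewrite ?eqmm // eqm_sym OaddE.
apply: (@eqm_trans _ _ n (pi ^+ b.1 * (pi ^+ k * a.2 n) + pi ^+ a.1 * (pi ^+ k * b.2 n))); last first.
  by apply: eqmD; apply: eqmM; rewrite ?eqmm.
rewrite (_ : _ + _ = pi ^+ k * (pi ^+ b.1 * a.2 n + pi ^+ a.1 * b.2 n)); last by ring.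
apply: eqmM; first exact: eqmm.
by apply: eqm_trans (OaddE _ _ _) _; apply: eqmD; exact: HM.
Qed.

Lemma frac_opp a k x : is_frac a k x -> is_frac (Kopp pi a) k (Oopp pi x).
Proof.
move=> [aK xO ax]; split; [exact: Oopp_elt|exact: Oopp_elt|] => n /=.
apply: (@eqm_trans _ _ n (pi ^+ k * (- a.2 n))); first by rewrite eqmM ?eqmm ?OoppE.
apply: (@eqm_trans _ _ n (pi ^+ a.1 * (- x n))); last by rewrite eqmM ?eqmm // eqm_sym OoppE.
by rewrite !mulrN eqmN.
Qed.

Lemma frac_sub a b k x y : is_frac a k x -> is_frac b k y -> is_frac (Ksub pi a b) k (Osub pi x y).
Proof. by move=> ax byy; apply/frac_add/frac_opp. Qed.

Lemma frac_mul a b k l x y : is_frac a k x -> is_frac b l y ->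
  is_frac (Kmul pi a b) (k + l) (Omul pi x y).
Proof.
move=> [aK xO ax] [bK yO byy]; split; [exact: Omul_elt|exact: Omul_elt|] => n /=.
apply: (@eqm_trans _ _ n (pi ^+ (k + l) * (a.2 n * b.2 n))); first by rewrite eqmM ?eqmm ?OmulE.
apply: (@eqm_trans _ _ n (pi ^+ (a.1 + b.1) * (x n * y n))); last by rewrite eqmM ?eqmm // eqm_sym OmulE.
by rewrite !exprD mulrACA [X in eqm n _ X]mulrACA eqmM.
Qed.

Lemma frac_const k x : Oelt x -> is_frac (k, x) k x.
Proof. by move=> xO; apply: (@frac_self (k, x)). Qed.

Lemma frac_shift a k m x : is_frac a k x -> is_frac a (k + m) (Omul pi (Oof pi (pi ^+ m)) x).
Proof.
move=> [aK xO ax]; split=> [//||n]; first exact/Omul_elt/xO/Oof_elt.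
apply: (@eqm_trans _ _ n (pi ^+ m * (pi ^+ a.1 * x n))).
  by rewrite exprD mulrAC mulrC eqmM ?eqmm.
rewrite mulrCA eqmM ?eqmm // eqm_sym; apply: eqm_trans (OmulE _ _ _) _.
by rewrite eqmM ?eqmm ?OofE.
Qed.

Lemma frac0 k : is_frac (Kzero pi) k (Oof pi 0).
Proof.
split; [exact: Oof_elt|exact: Oof_elt|] => n /=.
by rewrite /Oof mod0p !mulr0 eqmm.
Qed.

(* Negative indices are sent to [0], where every element of O has coordinate [0]. *)
Definition ztrunc (z : int) : nat := if z is Posz n then n else 0%N.

Lemma ztruncP (z : int) (n : nat) : (n%:Z <= z)%R -> (n <= ztrunc z)%N.
Proof. by case: z => [m|m] /=; lia. Qed.

(** By compatibility, the vanishing of the deepest coordinate implies that of all earlier ones. *)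
Lemma Kvge_coord a M : Kelt pi a -> Kvge a M <-> a.2 (ztrunc (M + a.1%:Z)) = 0.
Proof.
move=> aK; split=> [H|a0 n nM].
  case E : (M + a.1%:Z) => [n|n] /=; last exact: Oelt0.
  by apply: H; rewrite E.
have := Oelt_eq_le aK (Oof_elt 0) (ztruncP nM); rewrite /Oof !mod0p.
exact.
Qed.

(** This makes the valuation independent of the chosen denominator. Cancelling [pi ^+ l] costs [l]
    coordinates, hence the comparison at coordinate [K + l]. *)
Lemma proportional_coord0 k l x y (M : int) : Oelt x -> Oelt y ->
  (forall n, eqm n (pi ^+ k * y n) (pi ^+ l * x n)) ->
  y (ztrunc (M + l%:Z)) = 0 -> x (ztrunc (M + k%:Z)) = 0.
Proof.
move=> xO yO xy y0.
case EK : (M + k%:Z) => [K|K] /=; last exact: Oelt0.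
apply/(Oelt_eq0 _ xO)/(eqm_trans (q := x (K + l)%N)).
  by rewrite eqm_sym Oelt_eqm // leq_addr.
have : eqm (K + l) (pi ^+ k * y (K + l)%N) 0.
  (* If [M + l] is negative, then [K + l < k] and the factor [pi ^+ k] alone suffices. *)
  rewrite eqm0; case EL : (M + l%:Z) y0 => [L|L] /= y0; last first.
    by apply/dvdp_mulr/dvdp_exp2l; lia.
  rewrite (_ : (K + l = k + L)%N); last by lia.
  by rewrite exprD dvdp_mul2l ?expf_neq0 // -eqm0 -y0 Oelt_eqm // leq_addl.
rewrite eqm_sym => /eqm_trans /(_ (xy _)); rewrite eqm_sym !eqm0 addnC exprD.
by rewrite dvdp_mul2l ?expf_neq0.
Qed.

Lemma frac_vge a k x M : is_frac a k x -> Kvge a M <-> x (ztrunc (M + k%:Z)) = 0.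
Proof.
move=> [aK xO ax]; rewrite (Kvge_coord M aK); split; first exact: proportional_coord0.
by apply: proportional_coord0 => // n; rewrite eqm_sym.
Qed.

Lemma frac_eq a b k x y : is_frac a k x -> is_frac b k y ->
  Keq pi a b <-> forall n, x n = y n.
Proof.
move=> ax byy; have [_ xO _] := ax; have [_ yO _] := byy.
split=> [H n|xy M]; last first.
  by apply/(frac_vge M (frac_sub ax byy))/Osub_eq0.
have /(frac_vge _ (frac_sub ax byy)) := H (n%:Z - k%:Z).
by rewrite subrK => /(Osub_eq0 _ xO yO).
Qed.

(** The bound on the valuation makes [pi ^+ k * a.2] divisible by [pi ^+ a.1]. The division costs
    [a.1] coordinates, so coordinate [n] of the quotient is computed from coordinate [n + a.1]. *)
Lemma frac_exists a k : Kelt pi a -> Kvge a (- k%:Z) -> exists x, is_frac a k x.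
Proof.
move=> aK /(Kvge_coord _ aK); set l := a.1; set y := a.2 => y0.
have yd n : pi ^+ l %| pi ^+ k * y (n + l)%N.
  have [lk|/ltnW kl] := leqP l k; first by apply/dvdp_mulr/dvdp_exp2l.
  rewrite -(subnKC kl) exprD dvdp_mul2l ?expf_neq0 // -eqm0.
  rewrite (_ : 0 = y (l - k)%N); last by rewrite -y0; congr y; rewrite addrC subzn.
  by apply: Oelt_eqm => //; lia.
pose z n := (pi ^+ k * y (n + l)%N) %/ pi ^+ l.
have zE n : pi ^+ l * z n = pi ^+ k * y (n + l)%N by rewrite mulrC divpK.
exists (fun n => z n %% pi ^+ n); split=> //.
  apply: Oelt_mod => n; rewrite /eqm -(@dvdp_mul2l _ (pi ^+ l)) ?expf_neq0 //.
  rewrite mulrBr !zE -mulrBr -exprD addnC addSn dvdp_mull //.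
  by apply: Oelt_eqm; rewrite ?leqnSn.
move=> n; rewrite eqm_sym; apply: (@eqm_trans _ _ n (pi ^+ l * z n)).
  by rewrite eqmM ?eqmm ?eqm_mod.
by rewrite zE eqmM ?eqmm ?Oelt_eqm ?leq_addr.
Qed.

(* A failure on O would produce nested balls on which [P] is not uniform, converging to a
   point that contradicts the local hypothesis. *)
Lemma O_compact (P : Oseq F -> nat -> Prop) :
  (forall t k l, (k <= l)%N -> P t k -> P t l) ->
  (forall x, Oelt x -> exists n k, forall t, Oelt t -> t n = x n -> P t k) ->
  exists k, forall t, Oelt t -> P t k.
Proof.
move=> mono loc; apply: contrapT => nP.
pose bad n p := ~ exists k, forall t, Oelt t -> t n = p -> P t k.
(* The existential stands outside the implication so that choice later gives a total successor
   function. *)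
have step n p : exists p', bad n p -> [/\ bad n.+1 p', p' %% pi ^+ n = p & p' %% pi ^+ n.+1 = p'].
  apply: contrapT => no; have good p' : ~ [/\ bad n.+1 p', p' %% pi ^+ n = p & p' %% pi ^+ n.+1 = p'].
    by move=> H; apply: no; exists p'.
  have [bnp|nb] := pselect (bad n p); last by apply: no; exists 0.
  (* Polynomials reduced modulo [pi ^+ n.+1] fit into row vectors of length [s]. There are finitely
     many, so the largest of their bounds serves the whole ball. *)
  apply: bnp; set s := size (pi ^+ n.+1).
  have /choice [kf kfP] : forall v : 'rV[F]_s, exists k, forall t, Oelt t ->
      t n = p -> t n.+1 = rVpoly v -> P t k.
    move=> v; have [[k kP]|nk] := pselect (exists k, forall t, Oelt t -> t n.+1 = rVpoly v -> P t k).
      by exists k => t tO _; exact: kP.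
    exists 0%N => t tO tn tv; exfalso; apply: (good (rVpoly v)); split=> //.
      by rewrite -tv (tO.2 n).
    by rewrite -tv (tO.1 n.+1).
  exists (\max_v kf v) => t tO tn; apply: mono (leq_bigmax (poly_rV (t n.+1))) _.
  apply: kfP => //; rewrite poly_rV_K // ltnW //.
  by rewrite -(tO.1 n.+1) ltn_modp expf_neq0.
have /choice [nxt nxtP] : forall np : nat * {poly F}, exists p', bad np.1 np.2 ->
    [/\ bad np.1.+1 p', p' %% pi ^+ np.1 = np.2 & p' %% pi ^+ np.1.+1 = p'].
  by move=> [n p]; exact: step.
pose x := fix x n := if n is n'.+1 then nxt (n', x n') else 0.
have xbad n : bad n (x n).
  elim: n => [|n IH] /=; last by have [] := nxtP (n, x n) IH.
  by move=> [k kP]; apply: nP; exists k => t tO; apply: kP => //; exact: Oelt0.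
have xO : Oelt x.
  split=> n; last by have [] := nxtP (n, x n) (xbad n).
  by case: n => [|n]; [exact: mod0p|have [] := nxtP (n, x n) (xbad n)].
by have [n [k kP]] := loc x xO; apply: (xbad n); exists k.
Qed.

End Completion.

(** * Orthonormal bases *)

Section Basis.
Variables (F : finFieldType) (pi : {poly F}).
Hypothesis pi_n0 : pi != 0.
Local Notation eqm := (eqm pi).
Local Notation Oelt := (Oelt pi).
Local Notation Oof := (Oof pi).
Local Notation is_frac := (is_frac pi).

(** [X t] is the numerator of [G t] over the denominator 1. The rank [n0] does not depend on [t],
    which is what gives continuity of [G]. *)
Definition extends (g : {poly F} -> {poly F}) (G : Ofun F) (X : Oseq F -> Oseq F) :=
  (forall t, Oelt t -> is_frac (G t) 0 (X t)) /\
  forall N, exists n0, forall t, Oelt t -> forall n, (n0 <= n)%N -> eqm N (X t N) (g (t n)).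

Lemma extends_COK g G X : extends g G X -> COK pi G.
Proof.
move=> [GX Xg]; split=> [t /GX[]//|x xO M].
have [n0 n0P] := Xg (ztrunc (M + 0%:Z)).
exists n0 => y yO /(Osub_eq0 _ xO yO) xy.
have [_ XxO _] := GX x xO; have [_ XyO _] := GX y yO.
apply/(frac_vge pi_n0 M (frac_sub (GX x xO) (GX y yO))).
apply/Osub_eq0 => //; apply: (@Oelt_eq _ pi) => //.
apply: eqm_trans (n0P x xO _ (leqnn _)) _.
by rewrite xy eqm_sym n0P.
Qed.

Lemma eventually_all (R : nat -> nat -> Prop) :
  (forall i, exists n0, forall n, (n0 <= n)%N -> R i n) ->
  forall m, exists n0, forall n, (n0 <= n)%N -> forall i, (i < m)%N -> R i n.
Proof.
move=> H; elim=> [|m [n1 h1]]; first by exists 0%N.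
have [n2 h2] := H m; exists (maxn n1 n2) => n; rewrite geq_max => /andP [n1n n2n] i.
by rewrite ltnS leq_eqVlt => /predU1P [->|im]; [exact: h2|exact: h1].
Qed.

Lemma frac_sum k (h : nat -> Kt F) (y : nat -> Oseq F) m :
  (forall i, is_frac (h i) k (y i)) ->
  exists z, is_frac (Ksum pi m h) k z /\
    forall N, eqm N (z N) (\sum_(0 <= i < m) y i N).
Proof.
move=> hy; elim: m => [|m [z [zF zE]]].
  by exists (Oof 0); split=> [|N]; [exact: frac0|rewrite big_nil OofE].
exists (Oadd pi z (y m)); split=> [|N]; first exact: frac_add.
by rewrite big_nat_recr //=; apply: eqm_trans (OaddE _ _ _ _) _; rewrite eqmD ?eqmm.
Qed.

(** Near [x] the value [f t] differs from [f x] by an element of O, so the denominator of [f x]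
    serves for [f t] too. Compactness makes it uniform. *)
Lemma bounded_COK f : COK pi f -> exists k, forall t, Oelt t -> Kvge (f t) (- k%:Z).
Proof.
move=> [fK fC]; apply: (O_compact pi_n0 (P := fun t k => Kvge (f t) (- k%:Z))).
  by move=> t k l kl tk n nl; apply: tk; lia.
move=> x xO; have [n0 n0P] := fC x xO 0.
exists n0, (f x).1 => t tO tx.
have fxy : Kvge (Ksub pi (f x) (f t)) 0 by apply: n0P => //; apply/Osub_eq0.
(* Both values are brought to the denominator of exponent [(f x).1 + (f t).1]. *)
have /(frac_shift (f t).1) xF := frac_self (fK x xO).
have := frac_shift (f x).1 (frac_self (fK t tO)); rewrite addnC => tF.
move/(frac_vge pi_n0 _ (frac_sub xF tF)): fxy; rewrite add0r /=.
have [_ xF2 _] := xF; have [_ tF2 _] := tF.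
move=> /(Osub_eq0 _ xF2 tF2) xt.
apply/(frac_vge pi_n0 _ tF).
rewrite PoszD addKr /= -(Oelt_eq_le xF2 tF2 (leq_addl _ _) xt).
apply/(Oelt_eq0 _ xF2)/(eqm_trans (OmulE _ _ _ _))/(eqm_trans (eqmM (OofE _ _ _) (eqmm _ _ _))).
by rewrite eqm0 dvdp_mulr.
Qed.

Lemma ucont_COK f k Fx : COK pi f -> (forall t, Oelt t -> is_frac (f t) k (Fx t)) ->
  forall N, exists n, forall t u, Oelt t -> Oelt u -> t n = u n -> Fx t N = Fx u N.
Proof.
move=> [fK fC] fF N.
have FO t : Oelt t -> Oelt (Fx t) by move=> /fF [].
(* The second point [u] is quantified inside the predicate, so that compactness for one point yields
   uniform continuity. *)
have [||n nP] := O_compact pi_n0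
  (P := fun t n => forall u, Oelt t -> Oelt u -> t n = u n -> Fx t N = Fx u N).
- by move=> t k' l kl tP u tO uO tu; apply: tP => //; apply: (Oelt_eq_le tO uO kl).
- move=> x xO; have [n nP] := fC x xO (N%:Z - k%:Z).
  have {}nP u : Oelt u -> x n = u n -> Fx x N = Fx u N.
    move=> uO xu; apply/(Osub_eq0 _ (FO x xO) (FO u uO)).
    have /(frac_vge pi_n0 _ (frac_sub (fF x xO) (fF u uO))) : Kvge (Ksub pi (f x) (f u)) (N%:Z - k%:Z).
      by apply: nP => //; apply/Osub_eq0.
    by rewrite subrK.
  exists n, n => t tO tx u _ uO tu.
  by rewrite -(nP t) // -(nP u) // -tu.
- by exists n => t u tO uO; apply: nP.
Qed.

Lemma ucont_coord f k Fx N : COK pi f -> (forall t, Oelt t -> is_frac (f t) k (Fx t)) ->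
  ucont pi N (fun p => Fx (Oof p) N).
Proof.
move=> fC fF; have [n nP] := ucont_COK fC fF N; exists n => p q /eqmP pq.
by rewrite (nP _ (Oof q)) ?eqmm //; exact: Oof_elt.
Qed.

Variables (g : nat -> {poly F} -> {poly F}) (E : nat -> ({poly F} -> {poly F}) -> Prop).
Variables (G : nat -> Ofun F) (X : nat -> Oseq F -> Oseq F) (EK : Ofun F -> Prop).
Hypothesis HE : expansion_class pi g E.
Hypothesis GX : forall i, extends (g i) (G i) (X i).
Hypothesis EK_G : forall i, EK (G i).
Hypothesis EK_COK : forall f, EK f -> COK pi f.
Hypothesis EK_coord : forall f k Fx, EK f -> (forall t, Oelt t -> is_frac (f t) k (Fx t)) ->
  forall N, E N (fun p => Fx (Oof p) N).

(** The transfer common to both bases: [E] and [g] describe on polynomials, modulo each [pi ^+ N],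
    what [EK] and [G] are on O. *)
Lemma ONB_expansion : ONB pi EK G.
Proof.
split=> // f fE; have fC := EK_COK fE; have [k kP] := bounded_COK fC.
have /choice [Fx FxP] : forall t, exists x, Oelt t -> is_frac (f t) k x.
  move=> t; have [tO|ntO] := pselect (Oelt t); last by exists t.
  by have [x] := frac_exists pi_n0 (fC.1 t tO) (kP t tO); exists x.
have FO t : Oelt t -> Oelt (Fx t) by move=> /FxP [].
have /choice [cm cmP] : forall N, exists cm : (nat -> {poly F}) * nat,
    (forall i, (cm.2 <= i)%N -> cm.1 i = 0) /\
    forall p, eqm N (Fx (Oof p) N) (\sum_(0 <= i < cm.2) cm.1 i * g i p).
  by move=> N; have [c [m]] := expansion_exists pi_n0 HE (EK_coord fE FxP N); exists (c, m).
(* Coordinate [N] of a coefficient is read off the expansion modulo [pi ^+ N]. Expansions of levels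
   [N.+1] and [N] both represent [Fx] modulo [pi ^+ N], so uniqueness makes the coordinates
   coherent. *)
pose C i : Oseq F := fun N => (cm N).1 i %% pi ^+ N.
have CO i : Oelt (C i).
  apply: Oelt_mod => N; apply: (expansion_unique pi_n0 HE (cmP N.+1).1 (cmP N).1) => p.
  apply: eqm_trans (_ : eqm N (Fx (Oof p) N.+1) _); first by rewrite eqm_sym (eqm_le (leqnSn N)) // (cmP N.+1).2.
  apply: eqm_trans (_ : eqm N (Fx (Oof p) N) _); last exact: (cmP N).2.
  by apply: Oelt_eqm => //; apply/FO/Oof_elt.
have C0 N i : ((cm N).2 <= i)%N -> C i N = 0 by move=> /(cmP N).1; rewrite /C => ->; rewrite mod0p.
have cF i : is_frac (k, C i) k (C i) by exact: frac_const.
(* A sufficiently late truncation of [t] replaces [t] in [Fx] and in the first [m] basis functions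
   at once. *)
have density N t m : Oelt t -> exists n0, forall n, (n0 <= n)%N ->
    Fx t N = Fx (Oof (t n)) N /\ forall i, (i < m)%N -> eqm N (X i t N) (g i (t n)).
  move=> tO; have [n1 h1] := ucont_COK fC FxP N.
  have /eventually_all /(_ m) [n2 h2] : forall i, exists n0, forall n, (n0 <= n)%N ->
      eqm N (X i t N) (g i (t n)).
    by move=> i; have [n0 n0P] := (GX i).2 N; exists n0 => n /(n0P t tO).
  exists (maxn n1 n2) => n; rewrite geq_max => /andP [n1n /h2 H]; split=> //.
  apply: h1 => //; first exact: Oof_elt.
  rewrite /Oof; have /eqmP -> := Oelt_eqm tO n1n; by rewrite (tO.1 n1).
have approx N t m : Oelt t -> ((cm N).2 <= m)%N ->
    eqm N (Fx t N) (\sum_(0 <= i < m) C i N * X i t N).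
  move=> tO mN; have [n0 /(_ n0 (leqnn _)) [-> XE]] := density N t m tO.
  apply: eqm_trans ((cmP N).2 _) _; rewrite -(big_supp _ (cmP N).1 mN).
  rewrite [X in eqm N X _]big_nat [X in eqm N _ X]big_nat.
  by apply: eqm_sum => i /andP [_ im]; rewrite eqmM // eqm_sym ?eqm_mod ?XE.
exists (fun i => (k, C i)); split; [|split; [|split]].
- by move=> i; exact: CO.
- move=> M; exists (cm (ztrunc (M + k%:Z))).2 => n nN.
  by apply/(frac_vge pi_n0 M (cF n)); exact: C0.
(* Over the denominator [pi ^+ k], valuation at least [M] means that coordinate [M + k] vanishes. *)
- move=> M; set N := ztrunc (M + k%:Z); exists (cm N).2 => m mN t tO.
  have hF i : is_frac (Kmul pi (k, C i) (G i t)) k (Omul pi (C i) (X i t)).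
    by rewrite -[k in is_frac _ k]addn0; apply: frac_mul => //; exact: (GX i).1.
  have [z [zF zE]] := frac_sum m hF; have [_ zO _] := zF.
  apply/(frac_vge pi_n0 M (frac_sub (FxP t tO) zF))/(Osub_eq0 _ (FO t tO) zO).
  apply: (@Oelt_eq _ pi) => //; first exact: FO.
  rewrite -/N; apply: eqm_trans (approx N t m tO mN) _; rewrite eqm_sym.
  apply: eqm_trans (zE N) _; apply: eqm_sum => i _; exact: OmulE.
(* A bound on [f] makes its expansion modulo [pi ^+ N] zero, so freeness bounds the coefficients
   below [(cm N).2]; the later ones are zero at coordinate [N]. The converse evaluates the finite
   expansion. *)
move=> M; set N := ztrunc (M + k%:Z); split=> [fM n|cM t tO].
  apply/(frac_vge pi_n0 M (cF n)); rewrite -/N.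
  apply/(Oelt_eq0 _ (CO n)); apply: eqm_trans (eqm_mod _ _ _) _.
  have [nm|mn] := ltnP n (cm N).2; last by rewrite (cmP N).1 // eqmm.
  apply: (expansion_free pi_n0 HE _ nm) => p; rewrite eqm_sym.
  apply: eqm_trans ((cmP N).2 p).
  have /(frac_vge pi_n0 M (FxP _ (Oof_elt pi p))) -> := fM _ (Oof_elt pi p).
  exact: eqmm.
apply/(frac_vge pi_n0 M (FxP t tO)); rewrite -/N.
apply/(Oelt_eq0 _ (FO t tO)); apply: eqm_trans (approx N t _ tO (leqnn _)) _.
rewrite big1 ?eqmm // => i _.
by have /(frac_vge pi_n0 M (cF i)) := cM i; rewrite -/N => ->; rewrite mul0r.
Qed.

End Basis.

(** * Hyperderivatives on the completion and linearity over the coefficient field *)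

Section Hyperderivatives.
Variables (F : finFieldType) (pi : {poly F}).
Local Notation eqm := (eqm pi).
Local Notation Oelt := (Oelt pi).
Local Notation Oof := (Oof pi).
Local Notation is_frac := (is_frac pi).

(** As [D_j] loses at most [j] factors [pi], the eventual value defining [Dext] is already reached
    at rank [m + j]. *)
Lemma DextE j x m n : Oelt x -> (m + j <= n)%N ->
  Dext pi j x m = hyperD j (x n) %% pi ^+ m.
Proof.
move=> xO mn; rewrite /Dext.
case: xgetP => [p _ [N NP]|/(_ (hyperD j (x n) %% pi ^+ m))[]].
  rewrite -(NP _ (leq_maxl N n)); apply/eqmP/hyperD_eqm/(eqm_le mn).
  by rewrite Oelt_eqm // leq_maxr.
by exists n => l nl; apply/eqmP/hyperD_eqm/(eqm_le mn); rewrite Oelt_eqm.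
Qed.

Lemma Dext_eqm j x m n : Oelt x -> (m + j <= n)%N ->
  eqm m (Dext pi j x m) (hyperD j (x n)).
Proof. by move=> xO mn; rewrite (DextE xO mn) eqm_mod. Qed.

Lemma Dext_elt j x : Oelt x -> Oelt (Dext pi j x).
Proof.
move=> xO; split=> m; first by rewrite (DextE xO (leqnn _)) modp_id.
rewrite [RHS](@DextE _ _ _ (m.+1 + j) xO); last by rewrite leq_add2r.
by apply/eqmP/(eqm_le (leqnSn m))/Dext_eqm.
Qed.

Lemma Dext_frac j t : Oelt t -> is_frac (DextK pi j t) 0 (Dext pi j t).
Proof. by move=> tO; apply/frac_const/Dext_elt. Qed.

Lemma extends_Dext j : extends pi (hyperD j) (DextK pi j) (Dext pi j).
Proof.
split=> [t|N]; first exact: Dext_frac.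
by exists (N + j)%N => t tO n; exact: Dext_eqm.
Qed.

Lemma frac_pow a x m : is_frac a 0 x -> is_frac (Kpow pi a m) 0 (Opow pi x m).
Proof.
move=> ax; elim: m => [|m IH] /=; first exact/frac_const/Oof_elt.
exact: (frac_mul IH ax).
Qed.

Lemma extends_digit i : exists X, extends pi (digitD pi i) (digitExt pi (DextK pi) i) X.
Proof.
pose X := fix X m t := if m is m'.+1
  then Omul pi (X m' t) (Opow pi (Dext pi m' t) (digitQ pi m' i)) else Oof 1.
have XE m t N n : Oelt t -> (N + m <= n)%N ->
    eqm N (X m t N) (\prod_(j < m) hyperD j (t n) ^+ digitQ pi j i).
  move=> tO; elim: m => [|m IH] mn; first by rewrite big_ord0 OofE.
  rewrite big_ord_recr /=; apply: eqm_trans (OmulE _ _ _ _) _.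
  apply: eqmM; first by apply: IH; lia.
  apply: eqm_trans (OpowE _ _ _ _) _; apply/eqmX/Dext_eqm => //; lia.
exists (X i); split=> [t tO|N]; last by exists (N + i)%N => t tO n; exact: XE.
(* Only the number of factors varies in the induction; the digits remain those of the fixed [i]. *)
rewrite /digitExt; elim: {1 3}i => [|m IH] /=; first exact/frac_const/Oof_elt.
exact: (frac_mul IH (frac_pow _ (Dext_frac _ tO))).
Qed.

Hypothesis pi_n0 : pi != 0.
Hypothesis Qpi_gt : forall m, (m < Qpi pi ^ m)%N.

Lemma coefF_eqm c n m : coefF pi c -> eqm n (c n ^+ (Qpi pi ^ m)) (c n).
Proof.
move=> [cO cQ]; elim: m => [|m IH]; first by rewrite expn0 expr1 eqmm.
rewrite expnSr exprM; apply: eqm_trans (eqmX _ IH) _.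
by rewrite -[X in eqm _ _ (X _)]cQ eqm_sym OpowE.
Qed.

Lemma Dext_linear j : FpiLinear pi (DextK pi j).
Proof.
split=> [x y xO yO|c x cF xO].
  have xyO := Oadd_elt xO yO.
  apply/(frac_eq pi_n0 (Dext_frac _ xyO) (frac_add (Dext_frac _ xO) (Dext_frac _ yO))) => n.
  apply: (@Oelt_eq _ pi); [exact: Dext_elt|by apply: Oadd_elt; exact: Dext_elt|].
  apply: eqm_trans (Dext_eqm xyO (leqnn _)) _.
  apply: eqm_trans (hyperD_eqm (OaddE _ _ _ _)) _.
  rewrite /hyperD nderivnD eqm_sym; apply: eqm_trans (OaddE _ _ _ _) _.
  by apply: eqmD; exact: Dext_eqm.
have [cO _] := cF; have cxO := Omul_elt cO xO.
have cD : is_frac (Kmul pi (KofO c) (DextK pi j x)) 0 (Omul pi c (Dext pi j x)).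
  by apply: (@frac_mul _ _ _ _ 0 0); [exact: frac_const|exact: Dext_frac].
apply/(frac_eq pi_n0 (Dext_frac _ cxO) cD) => n.
apply: (@Oelt_eq _ pi); [exact: Dext_elt|by apply: Omul_elt => //; exact: Dext_elt|].
apply: eqm_trans (Dext_eqm cxO (leqnn _)) _.
(* An element of the coefficient field equals its [Q ^ j]-th power, which [D_j] treats as a constant
   because [j < Q ^ j]. *)
apply: (@eqm_trans _ _ n (hyperD j (c (n + j)%N ^+ (Qpi pi ^ j) * x (n + j)%N))).
  apply: hyperD_eqm; apply: eqm_trans (OmulE _ _ _ _) _.
  by rewrite eqmM ?eqmm // eqm_sym coefF_eqm.
rewrite /hyperD nderivn_pX ?pnat_QpiX //.
rewrite eqm_sym; apply: eqm_trans (OmulE _ _ _ _) _; apply: eqmM.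
  rewrite eqm_sym; apply: eqm_trans (eqm_le (leq_addr j n) (coefF_eqm _ _ cF)) _.
  by apply: Oelt_eqm; rewrite ?leq_addr.
exact: Dext_eqm.
Qed.

Hypothesis Fermat : forall a, eqm 1 (a ^+ Qpi pi) a.

(** By Frobenius, consecutive powers differ by [(a ^+ Q - a) ^+ (Q ^ l)], which is divisible by
    [pi ^+ (Q ^ l)], and [l < Q ^ l]. *)
Lemma Teichmuller_eqm a n m : (n <= m)%N -> eqm n (a ^+ (Qpi pi ^ m)) (a ^+ (Qpi pi ^ n)).
Proof.
have step l : eqm l (a ^+ (Qpi pi ^ l.+1)) (a ^+ (Qpi pi ^ l)).
  have pQ : [pchar {poly F}].-nat (Qpi pi ^ l)%N.
    by rewrite (eq_pnat _ (pchar_poly F)) pnat_QpiX.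
  have aQ : a ^+ (Qpi pi ^ l.+1) = (a ^+ Qpi pi - a) ^+ (Qpi pi ^ l) + a ^+ (Qpi pi ^ l).
    by rewrite -exprDn_pchar // subrK -exprM expnS.
  rewrite aQ /eqm addrK; apply: dvdp_trans (dvdp_exp2l _ (ltnW (Qpi_gt l))) _.
  by apply: dvdp_exp2r; have := Fermat a; rewrite /eqm expr1.
elim: m => [|m IH]; first by rewrite leqn0 => /eqP ->; exact: eqmm.
rewrite leq_eqVlt => /predU1P [->|nm]; first exact: eqmm.
by apply: eqm_trans (IH nm); apply: eqm_le (step m).
Qed.

Definition Teichmuller (a : {poly F}) : Oseq F := fun n => a ^+ (Qpi pi ^ n) %% pi ^+ n.

Lemma Teichmuller_coefF a : coefF pi (Teichmuller a).
Proof.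
have TO : Oelt (Teichmuller a) by apply: Oelt_mod => n; exact: Teichmuller_eqm.
split=> //; apply/funext => n.
suff : eqm n (Opow pi (Teichmuller a) (Qpi pi) n) (Teichmuller a n).
  move=> /eqmP; rewrite (TO.1 n) => <-; elim: (Qpi pi) => [|m _] /=; by rewrite modp_id.
apply: eqm_trans (OpowE _ _ _ _) _; apply: eqm_trans (eqmX _ (eqm_mod _ _ _)) _.
by rewrite -exprM -expnSr eqm_sym; apply: eqm_trans (eqm_mod _ _ _) _; rewrite eqm_sym Teichmuller_eqm.
Qed.

(** Linearity of [f] is applied at the Teichmuller lift of [a], then the lift is replaced by the
    nearby power [a ^+ (Q ^ m)]. *)
Lemma ulin_coord f k Fx : CLinOK pi f -> (forall t, Oelt t -> is_frac (f t) k (Fx t)) ->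
  forall N, ulin pi N (fun p => Fx (Oof p) N).
Proof.
move=> [fC [fD fM]] fF N; have OofO := Oof_elt pi; split; first exact: (ucont_coord pi_n0 N fC fF).
  move=> p q.
  have pq : Oadd pi (Oof p) (Oof q) = Oof (p + q).
    apply/funext => n; apply/eqmP; rewrite eqmD ?OofE //.
  have pqO := Oadd_elt (OofO p) (OofO q).
  have pqF := frac_add (fF _ (OofO p)) (fF _ (OofO q)).
  have /(frac_eq pi_n0 (fF _ pqO) pqF) H := fD _ _ (OofO p) (OofO q).
  by rewrite -pq H OaddE.
have [n nP] := ucont_COK pi_n0 fC fF N.
(* Precision [n] controls the argument of [Fx], and precision [N] the scalar in front of its
   value. *)
exists (maxn n N) => m; rewrite geq_max => /andP [nm Nm] a p.
have aF := Teichmuller_coefF a; have [aO _] := aF; have apO := Omul_elt aO (OofO p).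
have /(frac_eq pi_n0 (fF _ apO) (frac_mul (frac_const 0 aO) (fF _ (OofO p)))) := fM _ _ aF (OofO p).
move=> /(_ N) FE; rewrite -(nP (Omul pi (Teichmuller a) (Oof p))) //.
  rewrite FE; apply: eqm_trans (OmulE _ _ _ _) _; rewrite eqmM ?eqmm //.
  by apply: eqm_trans (eqm_mod _ _ _) _; rewrite eqm_sym Teichmuller_eqm.
apply/eqmP; rewrite eqmM ?OofE //.
  by apply: eqm_trans (eqm_mod _ _ _) _; rewrite eqm_sym Teichmuller_eqm.
Qed.

End Hyperderivatives.

Theorem theorem5p8 (F : finFieldType) (pi : {poly F}) :
  irreducible_poly pi ->
  ONB pi (CLinOK pi) (DextK pi) /\ ONB pi (COK pi) (digitExt pi (DextK pi)).
Proof.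
move=> pi_irr; have pi_n0 := pi_neq0 pi_irr.
have [k [rho [card_k rho0 rho_surj]]] := residue_field pi_irr.
have Q_gt := ltn_QpiX card_k.
have Fermat a : eqm pi 1 (a ^+ Qpi pi) a.
  by rewrite -(rho_eqm rho0) -[Qpi pi]expn1 (rho_X rho card_k).
split.
  apply: (ONB_expansion pi_n0 (hyperD_class pi_n0 rho0 rho_surj card_k) (extends_Dext pi)).
  - by move=> i; split; [apply: (extends_COK pi_n0 (extends_Dext pi i))|exact: Dext_linear].
  - by move=> f [].
  - exact: ulin_coord.
have [X XE] := choice (extends_digit pi).
apply: (ONB_expansion pi_n0 (digit_class pi_n0 rho0 rho_surj card_k) XE) => //.
- by move=> i; apply: (extends_COK pi_n0 (XE i)).
- by move=> f k' Fx fC fF N; exact: ucont_coord fC fF.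
Qed.
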